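(* Let $(A,d_A,Q)$ be a complete shifted $A_\infty$-algebra over a field $\mathbb{F}$. For $n\ge1$ let $Z^{-n}(A)$ be the space of degree $-n$ cocycles of $(A,d_A)$, and let $\bar\chi_n\colon Z^{-n}(A)\to\pi_n(\mathcal{N}_\bullet(A),0)$ be the function $\bar\chi_n(a):=[a\otimes\varphi_{[n]}]$. Then: (1) $\bar\chi_n$ is a homomorphism of abelian groups for all $n\ge2$. (2) The homomorphism $\bar\chi_n$ induces an isomorphism $H^{-n}(A)\xrightarrow{\cong}\pi_n(\mathcal{N}_\bullet(A),0)$ for all $n\ge2$.
   Context: Conventions: $\mathbb{F}$ is a field of arbitrary characteristic; graded objects are $\mathbb{Z}$-graded and unbounded, differentials have degree $+1$, and the Koszul sign rule is used. A complete cochain complex is a cochain complex $(A,d_A)$ over $\mathbb{F}$ with a descending filtration by subcomplexes $A=\mathcal{F}_1A\supseteq\mathcal{F}_2A\supseteq\cdots$ such that $A=\varprojlim_n A/\mathcal{F}_nA$. For a graded vector space $V$ let $\bar T(V)=\bigoplus_{k\ge1}V^{\otimes k}$ with the deconcatenation coproduct. A complete shifted $A_\infty$-algebra $(A,d_A,Q)$ is a complete cochain complex with a degree $1$ coderivation $Q$ of $\bar T(A)$, $Q^2=0$, with structure maps $Q^1_n\colon A^{\otimes n}\to A$ (the restriction to $A^{\otimes n}$ of $Q$ followed by projection to $A$), such that $Q^1_1=d_A$ and $Q^1_n(\mathcal{F}_{i_1}A\otimes\cdots\otimes\mathcal{F}_{i_n}A)\subseteq\mathcal{F}_{i_1+\cdots+i_n}A$.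 $\mathrm{MC}_{\mathrm{As}}(A)=\{a\in A^0:\sum_{n\ge1}Q^1_n(a^{\otimes n})=0\}$. For a finite-dimensional dg associative algebra $(B,\delta,\cdot)$, $A\otimes B$ is a complete shifted $A_\infty$-algebra with filtration $\mathcal{F}_nA\otimes B$, differential $d_A\otimes\mathrm{id}+\mathrm{id}\otimes\delta$, and for $k\ge2$ structure maps $(x_1\otimes b_1,\dots,x_k\otimes b_k)\mapsto\pm Q^1_k(x_1,\dots,x_k)\otimes b_1\cdots b_k$ (Koszul sign). $N^\ast(\Delta^n)$ is the dg algebra of normalized $\mathbb{F}$-valued cochains on the standard $n$-simplex: basis $\varphi_\sigma$ dual to the nondegenerate simplices $\sigma=(i_0<\cdots<i_k)$, $\varphi_\sigma$ in degree $k$; $\varphi_{[n]}$ is the basis element of top degree $n$; $\delta\varphi_\sigma=\sum_\tau\sum_i(-1)^i c_{\tau,i}\varphi_\tau$ (sum over nondegenerate $(k+1)$-simplices $\tau$ and $0\le i\le k+1$, $c_{\tau,i}=1$ if $d_i\tau=\sigma$, else $0$); cup product $(\phi\smile\psi)(i_0<\cdots<i_{k+\ell})=\phi(i_0<\cdots<i_k)\psi(i_k<\cdots<i_{k+\ell})$. $N^\ast(\Delta^\bullet)$ is a simplicial dg algebra by restriction. The nerve of $A$ is the Kan simplicial set $\mathcal{N}_n(A)=\mathrm{MC}_{\mathrm{As}}(A\otimes N^\ast(\Delta^n))$. For $a\in Z^{-n}(A)$, $n\ge1$, the element $a\otimes\varphi_{[n]}$ is an $n$-simplex of $\mathcal{N}_\bullet(A)$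 all of whose faces are $0$. $\pi_n(\mathcal{N}_\bullet(A),0)$ is the set of $\beta\in\mathcal{N}_n(A)$ with all faces $0$, modulo $\beta\sim\beta'$ if some $\eta\in\mathcal{N}_{n+1}(A)$ has $d_0\eta=\beta$, $d_1\eta=\beta'$, $d_j\eta=0$ for $j>1$; for $n\ge2$ the group operation is $[\alpha]+[\beta]=[d_1\omega]$ for any $\omega\in\mathcal{N}_{n+1}(A)$ with $d_0\omega=\beta$, $d_2\omega=\alpha$, $d_j\omega=0$ for $j>2$. *)

(* Defs.v *)
From HB Require Import structures.
From Stdlib Require Import Relation_Operators.
From mathcomp Require Import all_boot all_order all_algebra.
From mathcomp Require Import boolp classical_sets cardinality fsbigop.
From mathcomp Require Import finmap freeg.

Set Implicit Arguments.
Unset Strict Implicit.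
Unset Printing Implicit Defensive.

Import GRing.Theory.
Local Open Scope ring_scope.
Local Open Scope classical_set_scope.
Local Open Scope quotient_scope.

Section Span.
Context (F : fieldType) (V : lmodType F).

Definition lin_span (R : set V) : {pred V} := fun x =>
  `[< exists s : seq (F * V),
        (forall p, p \in s -> R p.2) /\ x = \sum_(p <- s) p.1 *: p.2 >].

Lemma lin_span_gen (R : set V) x : R x -> x \in lin_span R.
Proof.
move=> Rx; apply/asboolP; exists [:: (1, x)]; split.
  by move=> p; rewrite inE => /eqP->.
by rewrite big_seq1 scale1r.
Qed.

Lemma lin_spanZ (R : set V) a x : x \in lin_span R -> a *: x \in lin_span R.
Proof.
move=> /asboolP[s [Rs ->]]; apply/asboolP.
exists [seq (a * p.1, p.2) | p <- s]; split.
  by move=> p /mapP[q qs ->]; exact: (Rs q).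
by rewrite big_map scaler_sumr; apply: eq_bigr => p _; rewrite scalerA.
Qed.

Lemma lin_span_zmod (R : set V) : zmod_closed (lin_span R).
Proof.
split.
  by apply/asboolP; exists [::]; split=> //; rewrite big_nil.
move=> x y xR; rewrite -(scaleN1r y) => /(lin_spanZ (- 1)).
move: (-1 *: y) => z; move: xR => /asboolP[s [Rs ->]] /asboolP[t [Rt ->]].
apply/asboolP; exists (s ++ t); split; last by rewrite big_cat.
by move=> p; rewrite mem_cat => /orP[/Rs|/Rt].
Qed.

HB.instance Definition _ (R : set V) :=
  GRing.isZmodClosed.Build V (lin_span R) (lin_span_zmod R).

End Span.

Section Quotient.
Context (F : fieldType) (V : lmodType F) (R : set V).

Definition lquot := Quotient.quot (lin_span R : zmodClosed V).

HB.instance Definition _ := GRing.Zmodule.on lquot.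
HB.instance Definition _ := Quotient.on lquot.

Definition lquot_pi (x : V) : lquot := \pi_lquot x.

Lemma lquot_piP x y : lquot_pi x = lquot_pi y <-> x - y \in lin_span R.
Proof.
split; first by move/eqP; rewrite -Quotient.idealrBE.
by move=> xy; apply/eqP; rewrite -Quotient.idealrBE.
Qed.

Lemma lquot_reprK x : lquot_pi (repr x) = x. Proof. exact: reprK. Qed.

Lemma lquot_piD : {morph lquot_pi : x y / x + y}.
Proof. exact: (raddfD \pi_(Quotient.quot (lin_span R : zmodClosed V))). Qed.

Definition lquot_scale (a : F) (x : lquot) : lquot := lquot_pi (a *: repr x).

Lemma lquot_piZ a x : lquot_scale a (lquot_pi x) = lquot_pi (a *: x).
Proof.
apply/lquot_piP; rewrite -scalerBr; apply: lin_spanZ.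
by apply/lquot_piP; rewrite lquot_reprK.
Qed.

Lemma lquot_scaleA a b x : lquot_scale a (lquot_scale b x) = lquot_scale (a * b) x.
Proof. by rewrite -[x]lquot_reprK !lquot_piZ scalerA. Qed.
Lemma lquot_scale1 : left_id 1 lquot_scale.
Proof. by move=> x; rewrite -[x]lquot_reprK !lquot_piZ scale1r. Qed.
Lemma lquot_scaleDr : right_distributive lquot_scale +%R.
Proof.
move=> a x y; rewrite -[x]lquot_reprK -[y]lquot_reprK.
by rewrite -lquot_piD !lquot_piZ -lquot_piD scalerDr.
Qed.
Lemma lquot_scaleDl x : {morph lquot_scale^~ x : a b / a + b}.
Proof.
by move=> a b; rewrite -[x]lquot_reprK !lquot_piZ -lquot_piD scalerDl.
Qed.

HB.instance Definition _ := GRing.Zmodule_isLmodule.Build F lquot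
  lquot_scaleA lquot_scale1 lquot_scaleDr lquot_scaleDl.

Lemma lquot_pi_linear : linear lquot_pi.
Proof. by move=> a x y; rewrite lquot_piD -lquot_piZ. Qed.

HB.instance Definition _ := GRing.isLinear.Build F V lquot _ lquot_pi lquot_pi_linear.

End Quotient.

Section Presented.
Context (F : fieldType) (G : choiceType).

Lemma fglift_linear (W : lmodType F) (g : G -> W) : linear (fglift g).
Proof.
have liftD : additive (fglift g) by exact: lift_is_additive.
pose h : {additive {freeg G / F} -> W} := HB.pack (fglift g)
  (GRing.isZmodMorphism.Build _ _ (fglift g) liftD).
move=> a x y; rewrite [LHS](raddfD h); congr (_ + _).
have -> : a *: x = fgscale a x by [].
transitivity (a *: h (\sum_(z <- dom x) << coeff z x *g z >>)); last by rewrite freeg_sumE.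
rewrite [LHS](raddf_sum h) (raddf_sum h) scaler_sumr.
by apply: eq_bigr => i _ /=; rewrite !liftU scalerA.
Qed.

HB.instance Definition _ (W : lmodType F) (g : G -> W) :=
  GRing.isLinear.Build F {freeg G / F} W _ (fglift g) (fglift_linear g).

(* The vector space with generators [G] and relations [R]. *)
Definition presented (R : set {freeg G / F}) : lmodType F := lquot R.

Definition pgen (R : set {freeg G / F}) (x : G) : presented R :=
  lquot_pi R << x >>.

(* The linear map out of a presented space that is [g] on the generators; it
   is meaningful only under the hypothesis of [plift_linear]. *)
Definition plift R (W : lmodType F) (g : G -> W) (x : presented R) : W :=
  fglift g (repr (x : lquot R)).

Section Lift.
Context (R : set {freeg G / F}) (W : lmodType F) (g : G -> W).
Hypothesis gR : forall r : {freeg G / F}, R r -> fglift g r = 0.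

Lemma plift_pi x : plift g (lquot_pi R x) = fglift g x.
Proof.
apply/eqP; rewrite -subr_eq0 /plift -raddfB.
have /asboolP[s [Rs ->]] : repr (lquot_pi R x) - x \in lin_span R.
  by apply/lquot_piP; rewrite lquot_reprK.
rewrite raddf_sum big_seq big1 // => p ps.
by rewrite [LHS]linearZ_LR /= (gR (r := p.2)) ?scaler0 //; apply: Rs.
Qed.

Lemma plift_linear : linear (plift g : presented R -> W).
Proof.
move=> a x y; rewrite -[x]lquot_reprK -[y]lquot_reprK -linearP !plift_pi.
exact: linearP.
Qed.

Lemma plift_gen x : plift g (pgen R x) = g x.
Proof. by rewrite /pgen plift_pi liftU scale1r. Qed.

End Lift.
End Presented.

Section TensorProduct.
Context (F : fieldType).

Definition bilinear_rel (U W : lmodType F) : set {freeg (U * W)%type / F} :=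
  [set r | (exists a u u' w,
      r = << (a *: u + u', w) >> - a *: << (u, w) >> - << (u', w) >>) \/
    (exists a u w w',
      r = << (u, a *: w + w') >> - a *: << (u, w) >> - << (u, w') >>)].

Definition tensor (U W : lmodType F) : lmodType F := presented (@bilinear_rel U W).

Definition tpair (U W : lmodType F) (u : U) (w : W) : tensor U W :=
  pgen (@bilinear_rel U W) (u, w).

Definition tmap (U U' W W' : lmodType F) (f : {linear U -> U'})
    (g : {linear W -> W'}) : tensor U W -> tensor U' W' :=
  plift (fun p => tpair (f p.1) (g p.2)).

Lemma relP (G : choiceType) (R : set {freeg G / F}) a x y z :
  R (<< x >> - a *: << y >> - << z >>) ->
  pgen R x = a *: pgen R y + pgen R z.
Proof.
move=> Rr; apply/eqP; rewrite -subr_eq0 /pgen opprD addrA.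
rewrite -linearZ -!linearB -(linear0 (lquot_pi R)); apply/eqP/lquot_piP.
by rewrite subr0; apply: lin_span_gen.
Qed.

Lemma tpair_linearl (U W : lmodType F) (w : W) : linear ((@tpair U W)^~ w).
Proof. by move=> a u u'; apply: relP; left; exists a, u, u', w. Qed.

Lemma tpair_linearr (U W : lmodType F) (u : U) : linear (@tpair U W u).
Proof. by move=> a w w'; apply: relP; right; exists a, u, w, w'. Qed.

Lemma fglift_rel (G : choiceType) (W : lmodType F) (g : G -> W) a x y z :
  g x = a *: g y + g z -> fglift g (<< x >> - a *: << y >> - << z >>) = 0.
Proof. by move=> e; rewrite !raddfB /= linearZ_LR /= !liftU !scale1r e addrAC addrK subrr. Qed.

Section Map.
Context (U U' W W' : lmodType F) (f : {linear U -> U'}) (g : {linear W -> W'}).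

Let tmap_rel r : bilinear_rel r ->
  fglift (fun p : U * W => tpair (f p.1) (g p.2)) r = 0.
Proof.
by case=> [] [a [u [u' [w ->]]]]; apply: fglift_rel;
  rewrite /= linearP ?tpair_linearl ?tpair_linearr.
Qed.

Lemma tmap_linear : linear (tmap f g).
Proof. exact/plift_linear/tmap_rel. Qed.

HB.instance Definition _ :=
  GRing.isLinear.Build F (tensor U W) (tensor U' W') _ (tmap f g) tmap_linear.

Lemma tmap_tpair u w : tmap f g (tpair u w) = tpair (f u) (g w).
Proof. exact/plift_gen/tmap_rel. Qed.

End Map.
End TensorProduct.

(* The reduced tensor coalgebra: the generator [:: v1; ...; vk] stands for
   v1 (x) ... (x) vk, and the empty word is set to zero. *)
Section TensorCoalgebra.
Context (F : fieldType) (V : lmodType F).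

Definition word_rel : set {freeg (seq V) / F} :=
  [set r | r = << [::] >> \/ exists s a x y t,
     r = << s ++ (a *: x + y) :: t >> - a *: << s ++ x :: t >> - << s ++ y :: t >>].

Definition tbar : lmodType F := presented word_rel.

Definition word (s : seq V) : tbar := pgen word_rel s.

Lemma word_nil : word [::] = 0.
Proof.
rewrite -(linear0 (lquot_pi word_rel)); apply/lquot_piP.
by rewrite subr0; apply: lin_span_gen; left.
Qed.

Lemma word_multilinear s t a x y :
  word (s ++ (a *: x + y) :: t) = a *: word (s ++ x :: t) + word (s ++ y :: t).
Proof. by apply: relP; right; exists s, a, x, y, t. Qed.

Section Lift.
Context (W : lmodType F) (g : seq V -> W).
Hypothesis g0 : g [::] = 0.
Hypothesis gP : forall s t a x y,
  g (s ++ (a *: x + y) :: t) = a *: g (s ++ x :: t) + g (s ++ y :: t).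

Let word_lift_rel r : word_rel r -> fglift g r = 0.
Proof.
case=> [->|[s [a [x [y [t ->]]]]]]; first by rewrite liftU g0 scaler0.
exact: fglift_rel.
Qed.

Lemma word_lift_linear : linear (plift g : tbar -> W).
Proof. exact/plift_linear/word_lift_rel. Qed.

Lemma word_liftE s : plift g (word s) = g s.
Proof. exact/plift_gen/word_lift_rel. Qed.

End Lift.

Definition deconc_word (s : seq V) : tensor tbar tbar :=
  \sum_(1 <= i < size s) tpair (word (take i s)) (word (drop i s)).

Definition deconc : tbar -> tensor tbar tbar := plift deconc_word.

Let deconc_word0 : deconc_word [::] = 0.
Proof. by rewrite /deconc_word big_geq. Qed.

Let deconc_wordP s t a x y : deconc_word (s ++ (a *: x + y) :: t) =
  a *: deconc_word (s ++ x :: t) + deconc_word (s ++ y :: t).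
Proof.
rewrite /deconc_word !size_cat /= scaler_sumr -big_split /=.
apply: eq_bigr => i _; rewrite !take_cat !drop_cat.
case: ltnP => [_|si]; first by rewrite word_multilinear tpair_linearr.
case: (i - size s)%N => [|j] /=; last by rewrite word_multilinear tpair_linearl.
by rewrite -[(_ + y) :: t]cat0s word_multilinear tpair_linearr.
Qed.

Lemma deconc_linear : linear deconc.
Proof. exact: word_lift_linear. Qed.

HB.instance Definition _ :=
  GRing.isLinear.Build F tbar (tensor tbar tbar) _ deconc deconc_linear.

Lemma deconcE s : deconc (word s) = deconc_word s.
Proof. exact: word_liftE. Qed.

Definition letter (s : seq V) : V := if s is [:: x] then x else 0.

Definition corestr : tbar -> V := plift letter.

Let letterP s t a x y :
  letter (s ++ (a *: x + y) :: t) = a *: letter (s ++ x :: t) + letter (s ++ y :: t).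
Proof.
by case: s t => [|u [|u' s]] [|v t] //=; rewrite ?scaler0 ?addr0.
Qed.

Lemma corestr_linear : linear corestr.
Proof. exact: word_lift_linear. Qed.

HB.instance Definition _ :=
  GRing.isLinear.Build F tbar V _ corestr corestr_linear.

Lemma corestrE s : corestr (word s) = letter s.
Proof. exact: word_liftE. Qed.

Definition tbar_map (f : {linear V -> V}) : tbar -> tbar :=
  plift (fun s => word (map f s)).

Section Map.
Context (f : {linear V -> V}).

Let map_wordP s t a x y : word (map f (s ++ (a *: x + y) :: t)) =
  a *: word (map f (s ++ x :: t)) + word (map f (s ++ y :: t)).
Proof. by rewrite !map_cat /= linearP word_multilinear. Qed.

Lemma tbar_map_linear : linear (tbar_map f).
Proof. by apply: word_lift_linear => //=; apply: word_nil. Qed.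

HB.instance Definition _ :=
  GRing.isLinear.Build F tbar tbar _ (tbar_map f) tbar_map_linear.

Lemma tbar_mapE s : tbar_map f (word s) = word (map f s).
Proof. by apply: (word_liftE (g := fun s => word (map f s))) => //=; apply: word_nil. Qed.

End Map.
End TensorCoalgebra.

(* A Z-grading of V, given by the projections onto the homogeneous parts: V is
   their internal direct sum. *)
Record grading (F : fieldType) (V : lmodType F) := Grading {
  gproj : int -> {linear V -> V};
  gproj_idem : forall i j x, gproj i (gproj j x) = if i == j then gproj j x else 0;
  gproj_fin : forall x, finite_set [set i | gproj i x <> 0];
  gproj_sum : forall x, x = \sum_(i \in [set: int]) gproj i x }.

Section Koszul.
Context (F : fieldType) (V : lmodType F) (gr : grading V).

Definition homog (i : int) : set V := [set x | gproj gr i x = x].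

Definition koszul (x : V) : V :=
  \sum_(i \in [set: int]) (-1) ^+ `|i|%N *: gproj gr i x.

Lemma koszul_linear : linear koszul.
Proof.
move=> a x y; have [X XE] : exists X : {fset int},
    [set i | gproj gr i x <> 0] `|` [set i | gproj gr i y <> 0] = [set` X].
  by apply/finite_fsetP; rewrite finite_setU; split; apply: gproj_fin.
have [X0 Y0] : (forall i, i \notin X -> gproj gr i x = 0) /\
    (forall i, i \notin X -> gproj gr i y = 0).
  split=> i iX; apply: contra_notP (negP iX) => xi; rewrite -[is_true _]/([set` X] i) -XE;
  by [left | right].
rewrite /koszul !(fsbigTE X); last 3 first.
- by move=> i iX; rewrite Y0 ?scaler0.
- by move=> i iX; rewrite X0 ?scaler0.
- by move=> i iX; rewrite linearP X0 ?Y0 // scaler0 addr0 scaler0.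
rewrite scaler_sumr -big_split; apply: eq_bigr => i _ /=.
by rewrite linearP scalerDr !scalerA mulrC.
Qed.

HB.instance Definition _ := GRing.isLinear.Build F V V _ koszul koszul_linear.

Lemma koszul_homog i x : homog i x -> koszul x = (-1) ^+ `|i|%N *: x.
Proof.
move=> xi; rewrite /koszul (fsbigTE [fset i]%fset) ?big_seq_fset1 ?xi //.
move=> j; rewrite inE => ji; rewrite -xi gproj_idem (negPf ji).
exact: scaler0.
Qed.

(* The part of total degree m of the reduced tensor coalgebra. *)
Definition tbar_homog (m : int) : {pred tbar V} :=
  lin_span [set w | exists p : seq (int * V),
    [/\ (forall q, q \in p -> homog q.1 q.2),
        \sum_(q <- p) q.1 = m & w = word (map snd p)]].

End Koszul.

(* Completeness is required in each degree separately: the inverse limit is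
   that of graded vector spaces.  The filtration is indexed from 1; the axioms
   make [cc_filt A 0] equal to the whole space. *)
Record complete_complex (F : fieldType) := CompleteComplex {
  cc_space :> lmodType F;
  cc_gr : grading cc_space;
  cc_d : {linear cc_space -> cc_space};
  cc_filt : nat -> set cc_space;
  cc_d_deg : forall i x, homog cc_gr i x -> homog cc_gr (i + 1) (cc_d x);
  cc_d_d : forall x, cc_d (cc_d x) = 0;
  cc_filt0 : forall n, cc_filt n 0;
  cc_filtP : forall n a x y, cc_filt n x -> cc_filt n y -> cc_filt n (a *: x + y);
  cc_filt_gr : forall n i x, cc_filt n x -> cc_filt n (gproj cc_gr i x);
  cc_filt_d : forall n x, cc_filt n x -> cc_filt n (cc_d x);
  cc_filt1 : cc_filt 1%N = setT;
  cc_filt_desc : forall n, cc_filt n.+1 `<=` cc_filt n;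
  cc_separated : forall i x, homog cc_gr i x -> (forall n, cc_filt n x) -> x = 0;
  cc_complete : forall i (u : nat -> cc_space),
    (forall n, homog cc_gr i (u n)) ->
    (forall n, cc_filt n (u n.+1 - u n)) ->
    exists x, homog cc_gr i x /\ forall n, cc_filt n (x - u n) }.

(* The Koszul rule gives (id (x) Q) (u (x) v) = (-1)^|u| u (x) Q v, whence the
   sign operator in [ca_coder]. *)
Record complete_ainf (F : fieldType) := CompleteAinf {
  ca_cc :> complete_complex F;
  ca_Q : {linear tbar ca_cc -> tbar ca_cc};
  ca_deg : forall m w, w \in tbar_homog (cc_gr ca_cc) m ->
    ca_Q w \in tbar_homog (cc_gr ca_cc) (m + 1);
  ca_coder : forall w, deconc (ca_Q w) =
    tmap ca_Q idfun (deconc w) +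
    tmap (tbar_map (koszul (cc_gr ca_cc))) ca_Q (deconc w);
  ca_QQ : forall w, ca_Q (ca_Q w) = 0;
  ca_Q1 : forall x, corestr (ca_Q (word [:: x])) = cc_d ca_cc x;
  ca_filt : forall p : seq (nat * ca_cc),
    (forall q, q \in p -> cc_filt q.1 q.2) ->
    cc_filt (\sum_(q <- p) q.1)%N (corestr (ca_Q (word (map snd p)))) }.

(* [str_map [:: x1; ...; xk]] is Q^1_k (x1 (x) ... (x) xk). *)
Definition str_map (F : fieldType) (A : complete_ainf F) (s : seq A) : A :=
  corestr (ca_Q A (word s)).

(* Maurer-Cartan elements for structure maps [m] on a filtered space V with
   degree 0 part [V0]; the equation says that the series of the m (a, ..., a)
   converges to 0 for the filtration. *)
Definition MC_As (V : zmodType) (V0 : set V) (filt : nat -> set V)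
    (m : seq V -> V) : set V :=
  [set a | V0 a /\ forall N, exists K, forall k, (K <= k)%N ->
     filt N (\sum_(1 <= j < k.+1) m (nseq j a))].

(* Nondegenerate simplices of the standard n-simplex, as vertex sets. *)
Section Simplices.
Context (n : nat).

Definition simplex : Type := {s : {set 'I_n.+1} | s != finset.set0}.
HB.instance Definition _ := Finite.on simplex.
HB.instance Definition _ := SubType.on simplex.

Definition verts (s : simplex) : {set 'I_n.+1} := val s.

Definition sdim (s : simplex) : nat := #|verts s|.-1.

Lemma top_simplex_subproof : [set: 'I_n.+1]%SET != finset.set0.
Proof. by apply/set0Pn; exists ord0; rewrite finset.in_setT. Qed.

Definition top_simplex : simplex := Sub [set: 'I_n.+1]%SET top_simplex_subproof.

(* The value of a cochain on a vertex set, 0 on the empty set. *)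
Definition ev (V : zmodType) (f : {ffun simplex -> V}) (s : {set 'I_n.+1}) : V :=
  oapp f 0 (insub s).
End Simplices.

Section Cochains.
Context (F : fieldType) (n : nat).

Definition cochain := {ffun simplex n -> F}.

Definition phi (s : simplex n) : cochain := [ffun t => (t == s)%:R].

(* Deleting the vertex v of t is the face d_i, i the number of vertices of t
   before v. *)
Definition cobd (f : cochain) : cochain := [ffun t =>
  \sum_(v in verts t) (-1) ^+ #|[set u in verts t | (u < v)%N]%SET| *
    ev f (verts t :\ v)%SET].

(* For f of degree k only the vertex v number k of t contributes, through the
   front k-face and the complementary back face. *)
Definition cup (f g : cochain) : cochain := [ffun t =>
  \sum_(v in verts t) ev f [set u in verts t | (u <= v)%N]%SET *
                    ev g [set u in verts t | (v <= u)%N]%SET].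

Definition cup1 : cochain := [ffun t => (sdim t == 0%N)%:R].

Definition cup_prod (s : seq cochain) : cochain := foldr cup cup1 s.
End Cochains.

(* A (x) N^*(Delta^n): the sum of the x_s (x) phi_s is the function s |-> x_s. *)
Section TensorCochains.
Context (F : fieldType) (A : complete_ainf F) (n : nat).

Definition AN := {ffun simplex n -> A}.

Definition AN_tens (x : A) (b : cochain F n) : AN := [ffun s => b s *: x].

Definition AN_homog (i : int) : set AN :=
  [set f | forall s, homog (cc_gr A) (i - (sdim s)%:Z) (f s)].

Definition AN_filt (N : nat) : set AN := [set f | forall s, cc_filt N (f s)].

Definition AN_d (f : AN) : AN :=
  \sum_s (AN_tens (cc_d A (f s)) (phi F s) +
          AN_tens (koszul (cc_gr A) (f s)) (cobd (phi F s))).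

(* Moving b_i past x_j for i < j gives the sign (-1)^(|b_i| |x_j|). *)
Definition AN_twist (s : seq AN) (t : (size s).-tuple (simplex n)) : seq A :=
  [seq iter (\sum_(i < size s | (i < j)%N) sdim (tnth t i))%N
            (koszul (cc_gr A)) (nth 0 s j (tnth t j)) | j : 'I_(size s)].

Definition AN_str (s : seq AN) : AN :=
  if s is [:: f] then AN_d f else
  \sum_(t : (size s).-tuple (simplex n))
    AN_tens (str_map (AN_twist t)) (cup_prod [seq phi F b | b <- t]).

Definition nerve : set AN := MC_As (AN_homog 0) AN_filt AN_str.
End TensorCochains.

Section Faces.
Context (F : fieldType) (A : complete_ainf F).

(* Restriction along the simplicial map with vertex map h; normalized cochains
   vanish on degenerate simplices. *)
Definition AN_pull (m n : nat) (h : 'I_m.+1 -> 'I_n.+1) (f : AN A n) : AN A m :=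
  [ffun s => if #|h @: verts s| == #|verts s| then ev f (h @: verts s)%SET else 0].

(* Only used for 0 < n and i <= n. *)
Definition face (n i : nat) : AN A n -> AN A n.-1 :=
  AN_pull (fun j => inord (bump i j)).
End Faces.

Section HomotopyGroups.
Context (F : fieldType) (A : complete_ainf F) (n : nat).

Definition is_sphere : set (AN A n) :=
  [set b | nerve b /\ forall i : 'I_n.+1, face i b = 0].

Definition sphere : Type := {b : AN A n | `[< is_sphere b >]}.
HB.instance Definition _ := Choice.on sphere.
HB.instance Definition _ := SubType.on sphere.

Definition homotopic (b b' : sphere) : Prop := exists h : AN A n.+1,
  [/\ nerve h, face 0 h = val b, face 1 h = val b' &
      forall j : 'I_n.+2, (1 < j)%N -> face j h = 0].

Definition homotopicb : rel sphere := fun b b' =>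
  `[< clos_refl_sym_trans _ homotopic b b' >].

Lemma homotopicb_equiv : equiv_class_of homotopicb.
Proof.
split=> [b|b b'|b' b b''].
- by apply/asboolP; apply: rst_refl.
- by apply/asboolP/asboolP => ?; apply: rst_sym.
- by move=> /asboolP ? /asboolP ?; apply/asboolP; apply: rst_trans; eassumption.
Qed.

Canonical homotopicb_rel := EquivRelPack homotopicb_equiv.

Definition homotopy_group : Type := {eq_quot homotopicb}.
HB.instance Definition _ := Choice.on homotopy_group.
HB.instance Definition _ := Quotient.on homotopy_group.

Definition pi_class (b : sphere) : homotopy_group := \pi_homotopy_group b.

Definition pi_add_rel (x y z : homotopy_group) : Prop :=
  exists (a b c : sphere) (w : AN A n.+1),
  [/\ [/\ pi_class a = x, pi_class b = y & pi_class c = z],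
      [/\ nerve w, face 0 w = val b, face 1 w = val c & face 2 w = val a] &
      forall j : 'I_n.+2, (2 < j)%N -> face j w = 0].

(* [add] is the operation of pi_n (well defined and everywhere defined), and it
   makes pi_n an abelian group. *)
Record is_pi_group_law (add : homotopy_group -> homotopy_group -> homotopy_group) : Prop := {
  pi_law_spec : forall x y z, pi_add_rel x y z <-> add x y = z;
  pi_law_assoc : associative add;
  pi_law_comm : commutative add;
  pi_law_zero : exists2 e, left_id e add & exists opp, left_inverse e opp add }.
End HomotopyGroups.

Section Cohomology.
Context (F : fieldType) (A : complete_complex F) (k : int).

Definition is_cocycle : {pred A} := fun x =>
  `[< homog (cc_gr A) k x /\ cc_d A x = 0 >].

Lemma cocycle_zmod : zmod_closed is_cocycle.
Proof.
split; first by apply/asboolP; rewrite /homog /= !linear0.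
move=> x y /asboolP[/= xk dx] /asboolP[/= yk dy]; apply/asboolP.
by rewrite /homog /= !linearB /= xk yk dx dy subrr.
Qed.

HB.instance Definition _ := GRing.isZmodClosed.Build A is_cocycle cocycle_zmod.

Definition cocycle : Type := {x : A | is_cocycle x}.
HB.instance Definition _ := Choice.on cocycle.
HB.instance Definition _ := SubType.on cocycle.
HB.instance Definition _ := [SubChoice_isSubZmodule of cocycle by <:].

Definition is_coboundary : {pred cocycle} := fun z =>
  `[< exists y, homog (cc_gr A) (k - 1) y /\ cc_d A y = val z >].

Lemma coboundary_zmod : zmod_closed is_coboundary.
Proof.
split; first by apply/asboolP; exists 0; rewrite /homog /= !linear0.
move=> x y /asboolP[u [/= uk du]] /asboolP[v [/= vk dv]]; apply/asboolP.
by exists (u - v); rewrite /homog /= !linearB /= uk vk du dv.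
Qed.

HB.instance Definition _ :=
  GRing.isZmodClosed.Build cocycle is_coboundary coboundary_zmod.

Definition cohomology := Quotient.quot (is_coboundary : zmodClosed cocycle).
HB.instance Definition _ := GRing.Zmodule.on cohomology.
HB.instance Definition _ := Quotient.on cohomology.

Definition coh_class (z : cocycle) : cohomology := \pi_cohomology z.
End Cohomology.

Section Chi.
Context (F : fieldType) (A : complete_ainf F).

Lemma str_map0 (s : seq A) : 0 \in s -> str_map s = 0.
Proof.
move=> /splitPr[p q]; rewrite /str_map.
have := word_multilinear p q 0 0 0; rewrite scale0r addr0 => e.
have -> : word (p ++ 0 :: q) = 0.
  have /(congr1 (fun z => z - word (p ++ 0 :: q))) := word_multilinear p q 1 0 0.
  by rewrite scale1r addr0 scale1r addrK subrr => ->.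
by rewrite !linear0.
Qed.

Context (n : nat) (n_gt0 : (0 < n)%N) (a : cocycle A (- n%:Z)).

Definition top_elt : AN A n := AN_tens (val a) (phi F (top_simplex n)).

Let top_eltE s : top_elt s = if s == top_simplex n then val a else 0.
Proof.
by rewrite /top_elt !ffunE; case: eqP => _; rewrite ?scale1r ?scale0r.
Qed.

Let ev_top (s : {set 'I_n.+1}) : s != [set: 'I_n.+1]%SET ->
  ev (phi F (top_simplex n)) s = 0.
Proof.
rewrite /ev; case: insubP => //= t _ <- tT; rewrite ffunE.
by case: eqP => // e; rewrite e eqxx in tT.
Qed.

Let cup_top f (s : {set 'I_n.+1}) : s != [set: 'I_n.+1]%SET ->
  ev (cup (phi F (top_simplex n)) f) s = 0.
Proof.
rewrite /ev; case: insubP => //= t _ <- tT; rewrite ffunE big1 // => v _.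
rewrite ev_top ?mul0r //; apply: contra tT; rewrite -!finset.subTset.
by move=> Ts; apply: (fintype.subset_trans Ts); apply/fintype.subsetP => u; rewrite inE => /andP[].
Qed.

Let cup_top_top f : cup (phi F (top_simplex n)) (cup (phi F (top_simplex n)) f) = 0.
Proof.
apply/ffunP => t; rewrite !ffunE big1 // => v _.
set L := [set u in _ | _]%SET; set R := [set u in _ | _]%SET.
have [LT|/ev_top->] := eqVneq L [set: 'I_n.+1]%SET; last exact: mul0r.
have [RT|/cup_top->] := eqVneq R [set: 'I_n.+1]%SET; last exact: mulr0.
have : ord0 \in R by rewrite RT finset.in_setT.
rewrite inE /= => /andP[_ v0].
have : ord_max \in L by rewrite LT finset.in_setT.
by rewrite inE /= => /andP[_ vn]; move: (leq_trans vn v0); rewrite leqNgt n_gt0.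
Qed.

Let aP : homog (cc_gr A) (- n%:Z) (val a) /\ cc_d A (val a) = 0.
Proof. exact/asboolP/(valP a). Qed.

Let top_d : AN_d top_elt = 0.
Proof.
rewrite /AN_d big1 // => s _; rewrite top_eltE; case: eqP => [->|_].
  rewrite aP.2; apply/ffunP => t; rewrite !ffunE scaler0 add0r big1 ?scale0r //.
  move=> v vt; rewrite ev_top ?mulr0 //.
  by apply: contraTN isT => /eqP/setP/(_ v); rewrite !inE eqxx.
by rewrite !linear0; apply/ffunP => t; rewrite !ffunE !scaler0 addr0.
Qed.

Let top_str k : AN_str (nseq k top_elt) = 0.
Proof.
have [->|k1] := eqVneq k 1; first exact: top_d.
have -> : AN_str (nseq k top_elt) =
  \sum_(t : (size (nseq k top_elt)).-tuple (simplex n))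
    AN_tens (str_map (AN_twist t)) (cup_prod [seq phi F b | b <- t]).
  by case: k k1 => [|[|k]].
rewrite big1 // => t _; apply/ffunP => s; rewrite !ffunE.
have [k0|k0] := eqVneq k 0.
  have -> : AN_twist t = [::].
    by apply/nilP; rewrite /nilp size_map -cardE card_ord size_nseq k0.
  by rewrite /str_map word_nil !linear0.
have [/allP tT|/allPn[b /tnthP[j ->] bT]] := boolP (all (pred1 (top_simplex n)) t).
  have -> : [seq phi F b | b <- t] = nseq k (phi F (top_simplex n)).
    rewrite -map_nseq; congr map.
    have /all_pred1P -> : all (pred1 (top_simplex n)) t by apply/allP.
    by rewrite size_tuple size_nseq.
  have -> : cup_prod (nseq k (phi F (top_simplex n))) = 0.
    by case: k k0 k1 {t tT} => [|[|k]] // _ _; rewrite /= cup_top_top.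
  by rewrite ffunE scale0r.
rewrite str_map0 ?scaler0 //; apply/mapP; exists j; first by rewrite mem_enum.
have js : (j < k)%N by have := ltn_ord j; rewrite [X in (_ < X)%N]size_nseq.
by rewrite nth_nseq js top_eltE; move: bT => /= /negPf->; elim: (\sum_(_ < _ | _) _)%N => //= m <-; rewrite linear0.
Qed.

Lemma top_elt_sphere : `[< is_sphere top_elt >].
Proof.
apply/asboolP; split.
  split=> [s|N].
    rewrite top_eltE /homog /=; case: eqP => [->|_]; last exact: linear0.
    by rewrite /sdim /verts /= cardsT card_ord sub0r; exact: aP.1.
  exists 0 => k _; rewrite big1 => [s|j _]; last exact: top_str.
  by rewrite ffunE; exact: cc_filt0.
move=> i; apply/ffunP => s; rewrite !ffunE.
case: ifP => // /eqP cs; rewrite /ev; case: insubP => //= t _ tE.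
rewrite top_eltE; case: eqP => // tT; move: cs.
rewrite -tE tT /= cardsT card_ord => cs.
have := max_card (verts s); rewrite -cs card_ord; move: n_gt0.
by move/prednK=> ->; rewrite ltnn.
Qed.

Definition chi : homotopy_group A n := pi_class (Sub top_elt top_elt_sphere : sphere A n).

End Chi.

(* Main.v *)
Require Import Defs.
From Stdlib Require Import Relation_Operators.
From mathcomp Require Import all_boot all_algebra.
From mathcomp Require Import boolp zify.
Import GRing.Theory.
Local Open Scope ring_scope.

(** The simplices of the nerve that enter the definition of pi_n are spheres
    and fillers of spheres: they live on Delta^m with m <= n + 1 and vanish on
    every simplex of dimension less than n.  A cup product of k >= 2 basis
    cochains of degree at least n has degree at least 2n, which exceeds n + 1 as
    soon as n >= 2.  Hence every higher structure map vanishes on such an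
    element, and the Maurer-Cartan equation becomes the linear equation
    AN_d h = 0 ([nerve_linear]): the filtration is separated, so convergence to
    0 is equality with 0.

    The rest is linear.  A sphere is a cocycle placed on the top simplex
    ([sphere_top_elt]).  An element h of degree 0 on Delta^(n+1) with cocycles
    a_0, ..., a_(n+1) on its facets and y on its top simplex satisfies
    AN_d h = 0 exactly when d y + (-1)^n sum_i (-1)^i a_i = 0.  So a boundary
    made of spheres can be filled exactly when the alternating sum of its facets
    is a coboundary ([fillableP]).  With facets (a, b, 0, ..., 0) this says that
    homotopy is equality of cohomology classes, and with (b, c, a, 0, ..., 0)
    that the operation of pi_n is the addition of H^(-n).  The group law on pi_n
    is therefore the one transported along the bijection induced by chi. *)

(** * Degrees of cup products *)

Section CupDegree.
Set Implicit Arguments.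
Unset Strict Implicit.
Context (F : fieldType) (m : nat).

Lemma ev_in (V : zmodType) (f : {ffun simplex m -> V}) (s : simplex m) : ev f (verts s) = f s.
Proof. by rewrite /ev valK. Qed.

Lemma ev_neq0 (V : zmodType) (f : {ffun simplex m -> V}) X :
  ev f X != 0 -> exists2 s : simplex m, X = verts s & f s != 0.
Proof. by rewrite /ev; case: insubP => /= [s _ <-|]; [exists s | rewrite eqxx]. Qed.

Lemma card_verts (s : simplex m) : #|verts s| = (sdim s).+1.
Proof. by rewrite /sdim prednK // card_gt0; exact: valP s. Qed.

(** The cup product adds degrees: a vertex v with a nonzero contribution cuts s
    into a front and a back face that share exactly v. *)
Lemma cup_prod_phi_degree (t : seq (simplex m)) s :
  cup_prod [seq phi F b | b <- t] s != 0 -> sdim s = (\sum_(b <- t) sdim b)%N.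
Proof.
elim: t s => [|b t IH] s /=.
  by rewrite big_nil ffunE; have [->|] := eqVneq (sdim s) 0%N; rewrite // eqxx.
rewrite big_cons ffunE => nz.
have /existsP[v /andP[vs]] : [exists v, (v \in verts s) &&
    (ev (phi F b) [set u in verts s | (u <= v)%N]%SET *
     ev (cup_prod [seq phi F b | b <- t]) [set u in verts s | (v <= u)%N]%SET != 0)].
  apply: contraR nz; rewrite negb_exists => /forallP z; rewrite big1 // => v vs.
  by apply/eqP; move: (z v); rewrite vs negbK.
rewrite mulf_eq0 negb_or => /andP[/ev_neq0[b' Lb]].
rewrite ffunE => bb' /ev_neq0[r Rr /IH rE].
have {bb'} bb : b' = b by move: bb'; have [->|] := eqVneq b' b; rewrite // eqxx.
have LR := cardsUI [set u in verts s | (u <= v)%N]%SET [set u in verts s | (v <= u)%N]%SET.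
have LUR : ([set u in verts s | (u <= v)%N] :|: [set u in verts s | (v <= u)%N])%SET = verts s.
  by apply/setP => u; rewrite !inE -andb_orr leq_total andbT.
have LIR : ([set u in verts s | (u <= v)%N] :&: [set u in verts s | (v <= u)%N])%SET = [set v]%SET.
  apply/setP => u; rewrite !inE; apply/idP/eqP => [|->]; last by rewrite vs !leqnn.
  by case/andP => /andP[_ uv] /andP[_ vu]; apply/val_inj/eqP; rewrite eqn_leq uv vu.
move: LR; rewrite LUR LIR Lb Rr bb !card_verts cards1 rE; lia.
Qed.

End CupDegree.

(** * The Maurer-Cartan equation on elements that vanish on small simplices *)

Section Linearisation.
Set Implicit Arguments.
Unset Strict Implicit.
Context (F : fieldType) (A : complete_ainf F).

Lemma sdim_le m (s : simplex m) : (sdim s <= m)%N.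
Proof. by rewrite -ltnS -card_verts (leq_trans (max_card _)) // card_ord. Qed.

(** A summand indexed by the simplices t_1, ..., t_k vanishes either because h
    is zero on some t_i of dimension less than n, or because the cup product
    has degree at least k n > m. *)
Lemma AN_str_high m n k (h : AN A m) :
  (forall s, (sdim s < n)%N -> h s = 0) -> (m < n.*2)%N -> (1 < k)%N ->
  AN_str (nseq k h) = 0.
Proof.
case: k => [|[|k]] // h0 mn _.
have -> : AN_str (nseq k.+2 h) = \sum_(t : (size (nseq k.+2 h)).-tuple (simplex m))
   AN_tens (str_map (AN_twist t)) (cup_prod [seq phi F b | b <- t]) by [].
rewrite big1 // => t _; apply/ffunP => s; rewrite [LHS]ffunE [RHS]ffunE.
have [/allP tn|/allPn[b /tnthP[j ->] bn]] := boolP (all (fun b => n <= sdim b)%N t).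
  rewrite [cup_prod _ s](_ : _ = 0) ?scale0r //.
  apply/eqP/negPn/negP => /cup_prod_phi_degree sE.
  have : (\sum_(b <- t) n <= sdim s)%N.
    by rewrite sE big_seq [X in (_ <= X)%N]big_seq; apply: leq_sum => b /tn.
  rewrite big_const_seq count_predT size_tuple size_nseq iter_addn_0.
  have := sdim_le s; move: mn; nia.
rewrite str_map0 ?scaler0 //; apply/mapP; exists j; first by rewrite mem_enum.
have js : (j < k.+2)%N by have := ltn_ord j; rewrite [X in (_ < X)%N]size_nseq.
rewrite nth_nseq js h0; last by rewrite ltnNge.
by elim: (\sum_(_ < _ | _) _)%N => //= p <-; rewrite linear0.
Qed.

(** The defining sum runs over the faces and collects their coboundaries;
    evaluating it at s leaves only the facets of s. *)
Lemma AN_dE m (h : AN A m) s : AN_d h s = cc_d A (h s) +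
  \sum_(v in verts s) (-1) ^+ #|[set u in verts s | (u < v)%N]%SET| *:
     koszul (cc_gr A) (ev h (verts s :\ v)%SET).
Proof.
rewrite /AN_d sum_ffunE.
under eq_bigr do rewrite !ffunE.
rewrite big_split /=; congr (_ + _).
  rewrite (bigD1 s) //= eqxx scale1r big1 ?addr0 // => u /negPf us.
  by rewrite eq_sym us scale0r.
under eq_bigr do rewrite scaler_suml.
rewrite exchange_big /=; apply: eq_bigr => v vs.
under eq_bigr do rewrite -scalerA.
rewrite -scaler_sumr; congr (_ *: _).
rewrite /ev; case: insubP => [r _ _|_] /=; last first.
  by rewrite linear0 big1 // => u _; rewrite scale0r.
rewrite (bigD1 r) //= ffunE eqxx scale1r big1 ?addr0 // => u /negPf us.
by rewrite ffunE eq_sym us scale0r.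
Qed.

Lemma koszul_homog_in i x : homog (cc_gr A) i x -> homog (cc_gr A) i (koszul (cc_gr A) x).
Proof. by move=> xi; rewrite (koszul_homog xi) /homog /= linearZ /= xi. Qed.

Lemma homog_sum (I : Type) (r : seq I) (P : pred I) i (G : I -> A) :
  (forall k, P k -> homog (cc_gr A) i (G k)) ->
  homog (cc_gr A) i (\sum_(k <- r | P k) G k).
Proof. by move=> Gi; rewrite /homog /= linear_sum; apply: eq_bigr. Qed.

Lemma AN_d_homog m (h : AN A m) : AN_homog 0 h -> AN_homog 1 (AN_d h).
Proof.
move=> h0 s; rewrite AN_dE /homog /= linearD; congr (_ + _).
  by have := cc_d_deg (h0 s); rewrite sub0r addrC.
apply: homog_sum => v vs; rewrite /homog /= linearZ /=; congr (_ *: _).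
apply: koszul_homog_in; rewrite /ev; case: insubP => [r _ rE|_] /=; last exact: linear0.
have := h0 r; congr (homog _ _ _).
have := cardsD1 v (verts s); rewrite vs -rE -/(verts r) !card_verts; lia.
Qed.

(** Only the linear term of the Maurer-Cartan series survives, so its partial
    sums are all equal to AN_d h, which converges to 0 only if it lies in every
    step of the filtration.  The filtration is separated in each degree, so that
    AN_d h must be homogeneous for it to vanish. *)
Lemma nerve_linear m n (h : AN A m) :
  (forall s, (sdim s < n)%N -> h s = 0) -> (m < n.*2)%N ->
  nerve h <-> AN_homog 0 h /\ AN_d h = 0.
Proof.
move=> hn mn.
have sumE k : \sum_(1 <= j < k.+2) AN_str (nseq j h) = AN_d h.
  rewrite big_ltn // big_nat big1 ?addr0 // => j /andP[j1 _].
  exact: AN_str_high hn mn j1.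
split=> -[h0 dh]; split=> //.
  apply/ffunP => s; rewrite [RHS]ffunE; apply: (cc_separated (AN_d_homog h0 s)) => N.
  have [K /(_ K.+1 (leqnSn K))] := dh N.
  by rewrite sumE; apply.
move=> N; exists 1 => -[|k] // _; rewrite sumE dh => s.
by rewrite ffunE; apply: cc_filt0.
Qed.

End Linearisation.

(** * Faces *)

Section Homotopy.
Set Implicit Arguments.
Unset Strict Implicit.
Context (F : fieldType) (A : complete_ainf F).

Definition facet_at m (i : 'I_m.+2) (t : simplex m) : {set 'I_m.+2} := (lift i @: verts t)%SET.

Lemma facet_at_nonempty m (i : 'I_m.+2) t : facet_at i t != finset.set0.
Proof. by rewrite -card_gt0 card_imset ?card_verts //; apply: lift_inj. Qed.

(** The facet inclusion Delta^m -> Delta^(m+1) that misses the vertex i. *)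
Definition coface m (i : 'I_m.+2) (t : simplex m) : simplex m.+1 :=
  Sub (facet_at i t) (facet_at_nonempty i t).

Lemma sdim_coface m (i : 'I_m.+2) t : sdim (coface i t) = sdim t.
Proof. by rewrite /sdim /verts /= card_imset //; apply: lift_inj. Qed.

Lemma faceE m (i : 'I_m.+2) (h : AN A m.+1) t : face i h t = h (coface i t).
Proof.
rewrite ffunE; have E : (fun j : 'I_m.+1 => inord (bump i j)) =1 lift i.
  by move=> j; apply: val_inj; rewrite /= inordK //; exact: ltn_ord (lift i j).
rewrite (eq_imset _ E) card_imset ?eqxx; last exact: lift_inj.
by rewrite -(ev_in h).
Qed.

Lemma coface_surj m (i : 'I_m.+2) (s : simplex m.+1) :
  i \notin verts s -> exists t, s = coface i t.
Proof.
move=> si; have E : (lift i @: (lift i @^-1: verts s))%SET = verts s.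
  apply/setP => u; apply/imsetP/idP => [[w]|us]; first by rewrite inE => ws ->.
  case: (unliftP i u) us => [w ->|->] us; last by rewrite us in si.
  by exists w; rewrite // inE.
have ne : (lift i @^-1: verts s)%SET != finset.set0.
  by apply: contra (valP s) => /eqP e; rewrite -/(verts s) -E e imset0.
by exists (Sub (lift i @^-1: verts s)%SET ne : simplex m); apply: val_inj; rewrite /= /facet_at /verts /= E.
Qed.

Lemma missing_vertex m (s : simplex m) : s != top_simplex m -> exists i, i \notin verts s.
Proof.
move=> sT; apply/existsP; apply: contraR sT; rewrite negb_exists => /forallP sT.
apply/eqP/val_inj/setP => i; rewrite finset.in_setT.
by move: (sT i); rewrite negbK.
Qed.

Lemma sdim_top m : sdim (top_simplex m) = m.
Proof. by rewrite /sdim /verts /= cardsT card_ord. Qed.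

Lemma coface_top m (i j : 'I_m.+2) t :
  (coface j t == coface i (top_simplex m)) = (j == i) && (t == top_simplex m).
Proof.
apply/eqP/andP => [e|[/eqP-> /eqP->]] //.
have tT : t = top_simplex m.
  have := congr1 (@sdim _) e; rewrite !sdim_coface sdim_top => tm.
  apply/val_inj/eqP; rewrite eqEcard finset.subsetT /= cardsT card_ord.
  by rewrite -/(verts t) card_verts tm.
rewrite tT eqxx; split=> //; move: e; rewrite tT => /(congr1 val)/setP/(_ j) /=.
rewrite /facet_at; have -> : (j \in (lift j @: verts (top_simplex m))%SET) = false.
  by apply/imsetP => -[k _ /eqP]; rewrite (negPf (neq_lift _ _)).
by case: (unliftP i j) => [k ->|->] //; rewrite imset_f // finset.in_setT.
Qed.

(** * Filling boundaries made of spheres *)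

Section Cocycles.
Context (n : nat).
Implicit Types a : cocycle A (- n%:Z).

Lemma cocycleP a : homog (cc_gr A) (- n%:Z) (val a) /\ cc_d A (val a) = 0.
Proof. exact/asboolP/(valP a). Qed.

Lemma top_eltE a s : top_elt a s = if s == top_simplex n then val a else 0.
Proof. by rewrite /top_elt !ffunE; case: eqP => _; rewrite ?scale1r ?scale0r. Qed.

Lemma top_elt0 : top_elt (0 : cocycle A (- n%:Z)) = 0.
Proof. by apply/ffunP => s; rewrite top_eltE [RHS]ffunE; case: ifP. Qed.

(** Facet i is obtained by deleting the vertex i, which has i predecessors,
    whence (-1)^i; the factor (-1)^n is the Koszul sign of an element of degree
    -n. *)
Lemma AN_d_top (h : AN A n.+1) (a : 'I_n.+2 -> cocycle A (- n%:Z)) :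
  (forall i, h (coface i (top_simplex n)) = val (a i)) ->
  AN_d h (top_simplex n.+1) = cc_d A (h (top_simplex n.+1)) +
    (-1) ^+ n *: \sum_(i < n.+2) (-1) ^+ i *: val (a i).
Proof.
move=> ha; rewrite AN_dE; congr (_ + _); rewrite scaler_sumr.
rewrite (eq_bigl xpredT) => [|i]; last exact: finset.in_setT.
apply: eq_bigr => i _.
have -> : (verts (top_simplex n.+1) :\ i)%SET = verts (coface i (top_simplex n)).
  apply/setP => j; rewrite !inE andbT /verts /= /facet_at.
  case: (unliftP i j) => [k ->|->]; first by rewrite imset_f ?finset.in_setT // eq_sym neq_lift.
  by rewrite eqxx; apply/esym/imsetP => -[k _ /eqP]; rewrite (negPf (neq_lift _ _)).
rewrite ev_in ha (koszul_homog (cocycleP _).1) abszN absz_nat !scalerA mulrC.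
congr (_ * (-1) ^+ _ *: _).
rewrite -sum1dep_card -[RHS](card_ord i) -[RHS]sum1_card.
rewrite -(big_ord_narrow (F := fun=> 1) (ltnW (ltn_ord i))).
by apply: eq_bigl => u; rewrite finset.in_setT.
Qed.

Lemma coboundary_scale k (c : F) (x : A) : (exists y, homog (cc_gr A) k y /\ cc_d A y = c *: x) ->
  c != 0 -> exists y, homog (cc_gr A) k y /\ cc_d A y = x.
Proof.
move=> [y [yk dy]] c0; exists (c^-1 *: y); split.
  by rewrite /homog /= linearZ /= yk.
by rewrite linearZ /= dy scalerA mulVf // scale1r.
Qed.

Lemma proper_simplex_face m (h : AN A m.+1) (s : simplex m.+1) : s != top_simplex m.+1 ->
  exists i t, s = coface i t /\ h s = face i h t.
Proof.
move=> /missing_vertex[i /coface_surj[t ->]].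
by exists i, t; rewrite faceE.
Qed.

(** The element w is determined by its facets and by its value on the top
    simplex, and the equation AN_d w = 0 has content only there: on a facet it
    says that a_i is a cocycle, and on smaller simplices both w and AN_d w
    vanish.  The value on the top simplex is y up to the sign -(-1)^n. *)
Lemma fillableP (a : 'I_n.+2 -> cocycle A (- n%:Z)) : (2 <= n)%N ->
  (exists w : AN A n.+1, nerve w /\ forall i : 'I_n.+2, face i w = top_elt (a i)) <->
  exists y, homog (cc_gr A) (- n%:Z - 1) y /\ cc_d A y = \sum_(i < n.+2) (-1) ^+ i *: val (a i).
Proof.
move=> n2; have nn : (n.+1 < n.*2)%N by lia.
have degE : 0 - (sdim (top_simplex n.+1))%:Z = - n%:Z - 1 by rewrite sdim_top; lia.
split=> [[w [wN wa]]|[y [yk dy]]].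
  have w0 s : (sdim s < n)%N -> w s = 0.
    move=> sn; have sT : s != top_simplex n.+1.
      by apply: contraTneq sn => ->; rewrite sdim_top; lia.
    have [i [t [sE ->]]] := proper_simplex_face w sT.
    rewrite wa top_eltE; case: eqP => // tT.
    by move: sn; rewrite sE sdim_coface tT sdim_top ltnn.
  have [wh wd] := (nerve_linear w0 nn).1 wN.
  apply: (@coboundary_scale _ (- (-1) ^+ n)); last by rewrite oppr_eq0 signr_eq0.
  exists (w (top_simplex n.+1)); split; first by rewrite -degE; apply: wh.
  have /ffunP/(_ (top_simplex n.+1)) := wd; rewrite [RHS]ffunE.
  rewrite (AN_d_top (a := a)) => [/eqP|i].
    by rewrite addr_eq0 -scaleNr => /eqP.
  by rewrite -faceE wa top_eltE eqxx.
pose w : AN A n.+1 := [ffun s => if s == top_simplex n.+1 then - (-1) ^+ n *: y else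
  if [pick i | s == coface i (top_simplex n)] is Some i then val (a i) else 0].
have wT : w (top_simplex n.+1) = - (-1) ^+ n *: y by rewrite ffunE eqxx.
have ncT i t : (coface i t == top_simplex n.+1) = false.
  apply/negP => /eqP/(congr1 (@sdim _)); rewrite sdim_coface sdim_top => tn.
  by have := sdim_le t; rewrite tn ltnn.
have wc i t : w (coface i t) = if t == top_simplex n then val (a i) else 0.
  rewrite ffunE ncT; case: pickP => [j|/(_ i)]; rewrite coface_top.
    by case/andP => /eqP -> ->.
  by rewrite eqxx /= => ->.
have w0 s : (sdim s < n)%N -> w s = 0.
  move=> sn; have sT : s != top_simplex n.+1.
    by apply: contraTneq sn => ->; rewrite sdim_top; lia.
  have [i /coface_surj[t sE]] := missing_vertex sT.
  rewrite sE wc; case: eqP => // tT.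
  by move: sn; rewrite sE sdim_coface tT sdim_top ltnn.
exists w; split; last first.
  by move=> i; apply/ffunP => t; rewrite faceE wc top_eltE.
apply/(nerve_linear w0 nn); split=> [s|].
  have [->|/missing_vertex[i /coface_surj[t ->]]] := eqVneq s (top_simplex n.+1).
    by rewrite degE wT /homog /= linearZ /= yk.
  rewrite wc sdim_coface; case: eqP => [->|_]; last exact: linear0.
  by rewrite sdim_top sub0r; exact: (cocycleP _).1.
apply/ffunP => s; rewrite [RHS]ffunE.
have [->|/missing_vertex[i /coface_surj[t ->]]] := eqVneq s (top_simplex n.+1).
  rewrite (AN_d_top (a := a)) => [|i]; last by rewrite wc eqxx.
  by rewrite wT linearZ /= dy -scalerDl addNr scale0r.
rewrite AN_dE wc big1 => [|v vt].
  by rewrite addr0; case: eqP => _; rewrite ?linear0 //; exact: (cocycleP _).2.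
rewrite /ev; case: insubP => [r _ rE|_] /=; last by rewrite linear0 scaler0.
rewrite w0 ?linear0 ?scaler0 //.
have := cardsD1 v (verts (coface i t)); rewrite vt -rE -/(verts r) !card_verts sdim_coface.
have := sdim_le t; lia.
Qed.

(** The vanishing of the faces leaves only the value on the top simplex, and
    there the linearised equation makes it a cocycle. *)
Lemma sphere_top_elt (b : AN A n) : (0 < n)%N -> is_sphere b ->
  exists a : cocycle A (- n%:Z), b = top_elt a.
Proof.
case: n b => // m b _ [bN bf].
have b0 s : s != top_simplex m.+1 -> b s = 0.
  by move=> /(proper_simplex_face b)[i [t [_ ->]]]; rewrite bf ffunE.
have bd s : (sdim s < m.+1)%N -> b s = 0.
  move=> sm; apply: b0; apply: contraTneq sm => ->.
  by rewrite sdim_top ltnn.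
have [|bh dB] := (nerve_linear bd _).1 bN; first lia.
have ac : b (top_simplex m.+1) \in @is_cocycle _ A (- m.+1%:Z).
  apply/asboolP; split.
    by have := bh (top_simplex m.+1); rewrite sdim_top sub0r.
  have /ffunP/(_ (top_simplex m.+1)) := dB; rewrite [RHS]ffunE AN_dE.
  rewrite big1 ?addr0 // => v vT; rewrite /ev.
  case: insubP => [r _ rE|_] /=; last by rewrite linear0 scaler0.
  rewrite b0 ?linear0 ?scaler0 //; apply: contraTneq vT => rT.
  by move/setP: rE => /(_ v); rewrite rT /verts /= !inE eqxx.
exists (Sub (b (top_simplex m.+1)) ac : cocycle A _); apply/ffunP => s; rewrite /top_elt !ffunE.
have [->|/b0->] := eqVneq s (top_simplex m.+1); first by rewrite scale1r.
by rewrite scale0r.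
Qed.

End Cocycles.

(** * Homotopy classes and cohomology classes *)

Section Classes.
Context (n : nat) (n2 : (2 <= n)%N).
Implicit Types a b c : cocycle A (- n%:Z).

Lemma coh_classP a b : coh_class a = coh_class b <->
  exists y, homog (cc_gr A) (- n%:Z - 1) y /\ cc_d A y = val a - val b.
Proof.
split=> [/eqP|yP]; first by rewrite -Quotient.idealrBE => /asboolP.
by apply/eqP; rewrite -Quotient.idealrBE; apply/asboolP.
Qed.

Lemma coh_class_surj (u : cohomology A (- n%:Z)) : exists a, coh_class a = u.
Proof. by exists (repr u); rewrite /coh_class reprK. Qed.

Lemma coh_classD a b : coh_class (a + b) = coh_class a + coh_class b.
Proof. exact: (raddfD \pi_(Quotient.quot (@is_coboundary F A (- n%:Z) : zmodClosed _))%qT). Qed.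

Definition top_sphere a : sphere A n := Sub (top_elt a) (top_elt_sphere (ltnW n2) a).

Lemma sphere_top (b : sphere A n) : exists a, b = top_sphere a.
Proof.
have [a ba] := sphere_top_elt (ltnW n2) (asboolW (valP b)).
by exists a; apply: val_inj.
Qed.

(** The case of at most three nonzero facets covers both the homotopies
    (a2 = 0) and the fillers that define the operation of pi_n. *)
Lemma fillable3 a0 a1 a2 :
  (exists w : AN A n.+1,
    [/\ nerve w, face 0 w = top_elt a0, face 1 w = top_elt a1, face 2 w = top_elt a2 &
      forall j : 'I_n.+2, (2 < j)%N -> face j w = 0]) <->
  coh_class (a0 + a2) = coh_class a1.
Proof.
pose a (i : 'I_n.+2) := nth 0 [:: a0; a1; a2] i.
have sumE : \sum_(i < n.+2) (-1) ^+ i *: val (a i) = val (a0 + a2) - val a1.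
  rewrite -(big_mkord xpredT (fun i => (-1) ^+ i *: val (nth 0 [:: a0; a1; a2] i))).
  rewrite 3?big_ltn //; last by lia.
  rewrite big_nat big1 => [|i /andP[i3 _]]; last by rewrite nth_default // scaler0.
  by rewrite /= expr0 expr1 sqrrN expr1n !scale1r scaleN1r addr0 addrCA addrC.
apply: (iff_trans _ (iff_sym (coh_classP _ _))); rewrite -sumE.
apply: (iff_trans _ (fillableP a n2)).
split=> -[w]; last first.
  case=> wN wa; exists w.
  have L k (kn : (k < n.+2)%N) : face k w = top_elt (a (Ordinal kn)) by rewrite -wa.
  split=> //; [exact: L | exact: L | by apply: L; lia |].
  by move=> j j2; rewrite wa /a nth_default // top_elt0.
case=> wN w0 w1 w2 w3; exists w; split=> // -[[|[|[|j]]] jn] //.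
by rewrite w3 // /a nth_default // top_elt0.
Qed.

Lemma homotopicP a b : homotopic (top_sphere a) (top_sphere b) <-> coh_class a = coh_class b.
Proof.
rewrite -[X in coh_class X = _]addr0 -fillable3 top_elt0.
split=> -[w] => [[wN w0 w1 w2]|[wN w0 w1 w2 w3]]; exists w; split=> //.
- by have := w2 (inord 2); rewrite inordK; [apply | lia].
- by move=> j j2; apply: w2; apply: ltnW.
- by move=> j; rewrite leq_eqVlt => /orP[/eqP <-|/w3].
Qed.

(** The equivalence relation generated by homotopy is no larger than homotopy:
    by [homotopicP] the latter already is the pull-back of an equality. *)
Lemma chi_eq a b : chi (ltnW n2) a = chi (ltnW n2) b <-> coh_class a = coh_class b.
Proof.
split=> [/eqP|ab]; last first.
  apply/eqP; rewrite eqmodE; apply/asboolP/rst_step.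
  exact/homotopicP.
rewrite eqmodE => /asboolP.
(* R is stated over all representatives, so that the induction on the closure
   can pass through intermediate spheres. *)
pose R (x y : sphere A n) := forall a b, x = top_sphere a -> y = top_sphere b -> coh_class a = coh_class b.
suff H x y : clos_refl_sym_trans _ (@homotopic _ A n) x y -> R x y.
  by move=> /H; apply.
elim=> {x y} [x y xy|x|x y _ IH|x y z _ IHx _ IHy] a' b'.
- by move=> xa yb; apply/homotopicP; rewrite -xa -yb.
- move=> -> /(congr1 val)/= ab; congr coh_class; apply: val_inj.
  by move/ffunP/(_ (top_simplex n)): ab; rewrite !top_eltE eqxx.
- by move=> xa yb; apply/esym/IH.
- by move=> xa zb; have [c yc] := sphere_top y; rewrite (IHx a' c) // (IHy c b').
Qed.

Lemma chi_surj (x : homotopy_group A n) : exists a, x = chi (ltnW n2) a.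
Proof.
have [a xa] := sphere_top (repr x).
by exists a; rewrite /chi -/(top_sphere a) -xa /pi_class reprK.
Qed.

(** A filler with facets (b, c, a, 0, ..., 0) exists exactly when
    [b] - [c] + [a] = 0; by [chi_eq] the choice of representatives in
    [pi_add_rel] does not matter. *)
Lemma pi_add_relP a b c :
  pi_add_rel (chi (ltnW n2) a) (chi (ltnW n2) b) (chi (ltnW n2) c) <->
  coh_class a + coh_class b = coh_class c.
Proof.
split=> [[x [y [z [w [[xa yb zc] [wN w0 w1 w2] w3]]]]]|].
  have [a' xE] := sphere_top x; have [b' yE] := sphere_top y.
  have [c' zE] := sphere_top z; subst x y z.
  move/chi_eq: xa => <-; move/chi_eq: yb => <-; move/chi_eq: zc => <-.
  by rewrite addrC -coh_classD; apply/fillable3; exists w.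
rewrite addrC -coh_classD => /fillable3[w [wN w0 w1 w2 w3]].
by exists (top_sphere a), (top_sphere b), (top_sphere c), w.
Qed.

End Classes.
End Homotopy.

(** * The isomorphism of cohomology with homotopy *)

Theorem theorem7p3 (F : fieldType) (A : complete_ainf F) (n : nat)
    (n_ge2 : (2 <= n)%N) :
  exists add : homotopy_group A n -> homotopy_group A n -> homotopy_group A n,
  [/\ is_pi_group_law add,
      forall a b : cocycle A (- n%:Z),
        chi (ltnW n_ge2) (a + b) = add (chi (ltnW n_ge2) a) (chi (ltnW n_ge2) b)
    & exists f : cohomology A (- n%:Z) -> homotopy_group A n,
        [/\ forall a : cocycle A (- n%:Z), f (coh_class a) = chi (ltnW n_ge2) a,
            forall u v, f (u + v) = add (f u) (f v)
          & bijective f]].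
Proof.
pose f (u : cohomology A (- n%:Z)) := chi (ltnW n_ge2) (repr u).
have fE a : f (coh_class a) = chi (ltnW n_ge2) a.
  by apply/chi_eq; rewrite /coh_class reprK.
have f_surj x : exists u, f u = x.
  by have [a ->] := chi_surj n_ge2 x; exists (coh_class a).
pose g x := sval (cid (f_surj x)).
have gK : cancel g f by move=> x; rewrite /g; case: cid.
have fK : cancel f g.
  move=> u; have := gK (f u).
  have [a <-] := coh_class_surj (g (f u)); have [b <-] := coh_class_surj u.
  by rewrite !fE => /chi_eq.
exists (fun x y => f (g x + g y)); split.
- split=> [x y z|x y z|x y|].
  + rewrite -[x in pi_add_rel x]gK -[y in pi_add_rel _ y]gK -[z]gK.
    have [a <-] := coh_class_surj (g x); have [b <-] := coh_class_surj (g y).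
    have [c <-] := coh_class_surj (g z).
    rewrite !fE (pi_add_relP n_ge2) -fE; split=> [->//|/(can_inj fK)//].
  + by rewrite !fK addrA.
  + by rewrite addrC.
  + exists (f 0) => [x|]; first by rewrite fK add0r gK.
    by exists (fun x => f (- g x)) => x; rewrite fK addNr.
- by move=> a b; rewrite -!fE !fK coh_classD.
- by exists f; split=> // [u v|]; [rewrite !fK | exists g].
Qed.
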